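(* Let $S:\mathbb{R}^n\times\mathbb{R}^m\to\mathbb{R}$ be convex-concave and continuously differentiable, with at least one saddle point, and let $\rho>0$. Define $\tilde S(u,y):=\min_{x\in\mathbb{R}^n}\{S(x,y)+\frac{\rho}{2}\|x-u\|^2\}$ and let $\tilde x(u,y)$ denote the unique minimizer. Then the proximal saddle flow dynamics $$\dot u=-\nabla_u\tilde S(u,y)=-(\rho u-\rho\tilde x(u,y)),\qquad \dot y=+\nabla_y\tilde S(u,y)=\nabla_yS(\tilde x(u,y),y)$$ globally asymptotically converge to some saddle point $(u_\star,y_\star)$ of $\tilde S$ (every trajectory from an arbitrary initial point converges as $t\to\infty$ to some saddle point of $\tilde S$, possibly depending on the trajectory), with $(x_\star=u_\star,y_\star)$ being a saddle point of $S$.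
   Context: $S$ is convex-concave if $S(\cdot,y)$ is convex for every $y$ and $S(x,\cdot)$ is concave for every $x$. A saddle point of a function $T:\mathbb{R}^n\times\mathbb{R}^m\to\mathbb{R}$ is a point $(x_\star,y_\star)$ with $T(x_\star,y)\le T(x_\star,y_\star)\le T(x,y_\star)$ for all $x,y$. Under the stated hypotheses $\tilde S$ is convex in $u$, concave in $y$ and continuously differentiable with the gradient shown in the dynamics. *)

(* Defs.v *)
From mathcomp Require Export all_boot all_order all_algebra.
From mathcomp Require Export all_classical all_reals all_analysis.
Export Order.TTheory GRing.Theory Num.Theory.
Export numFieldNormedType.Exports.

#[export] Set Implicit Arguments.
#[export] Unset Strict Implicit.
#[export] Unset Printing Implicit Defensive.

Open Scope classical_set_scope.
Open Scope ring_scope.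

(* Squared Euclidean norm; the library's norm on ['rV[R]_n] is the sup norm,
   which is only used here through the topology it induces. *)
Definition sqnorm (R : realType) (n : nat) (x : 'rV[R]_n) : R :=
  \sum_(i < n) x 0 i ^+ 2.

Definition grad (R : realType) (n : nat) (f : 'rV[R]_n -> R) (x : 'rV[R]_n) :
    'rV[R]_n :=
  \row_(i < n) 'D_(delta_mx 0 i) f x.

Definition grad1 (R : realType) (n m : nat) (T : 'rV[R]_n -> 'rV[R]_m -> R)
    (x : 'rV[R]_n) (y : 'rV[R]_m) : 'rV[R]_n := grad (T ^~ y) x.

Definition grad2 (R : realType) (n m : nat) (T : 'rV[R]_n -> 'rV[R]_m -> R)
    (x : 'rV[R]_n) (y : 'rV[R]_m) : 'rV[R]_m := grad (T x) y.

Definition continuously_differentiable (R : realType) (n m : nat)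
    (T : 'rV[R]_n -> 'rV[R]_m -> R) : Prop :=
  [/\ forall p : 'rV[R]_n * 'rV[R]_m,
        differentiable (fun q : 'rV[R]_n * 'rV[R]_m => T q.1 q.2) p,
      continuous (fun p : 'rV[R]_n * 'rV[R]_m => grad1 T p.1 p.2)
    & continuous (fun p : 'rV[R]_n * 'rV[R]_m => grad2 T p.1 p.2)].

Definition convex_concave (R : realType) (n m : nat)
    (T : 'rV[R]_n -> 'rV[R]_m -> R) : Prop :=
  (forall y, convex_function setT (T ^~ y)) /\
  (forall x, convex_function setT (fun y => - T x y)).

Definition saddle_point (R : realType) (n m : nat)
    (T : 'rV[R]_n -> 'rV[R]_m -> R) (xs : 'rV[R]_n) (ys : 'rV[R]_m) : Prop :=
  forall x y, T xs y <= T xs ys /\ T xs ys <= T x ys.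

Definition minimizer (R : realType) (n : nat) (f : 'rV[R]_n -> R) :
    set 'rV[R]_n :=
  [set x | forall z, f x <= f z].

Definition prox_objective (R : realType) (n m : nat)
    (S : 'rV[R]_n -> 'rV[R]_m -> R) (rho : R) (u : 'rV[R]_n) (y : 'rV[R]_m)
    (x : 'rV[R]_n) : R :=
  S x y + rho / 2 * sqnorm (x - u).

(* The minimum is written as an infimum; that it is attained is the
   nonemptiness of [minimizer (prox_objective S rho u y)]. *)
Definition Stilde (R : realType) (n m : nat)
    (S : 'rV[R]_n -> 'rV[R]_m -> R) (rho : R) (u : 'rV[R]_n) (y : 'rV[R]_m) :
    R :=
  inf (range (prox_objective S rho u y)).

Definition xtilde (R : realType) (n m : nat)
    (S : 'rV[R]_n -> 'rV[R]_m -> R) (rho : R) (u : 'rV[R]_n) (y : 'rV[R]_m) :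
    'rV[R]_n :=
  get (minimizer (prox_objective S rho u y)).

(* A trajectory is a solution on [0, +oo[, with initial point (u 0, y 0).
   Asking for continuity on [0, +oo[ and the differential equation on ]0, +oo[
   avoids one-sided derivatives at 0, and puts no constraint on the values of
   [u] and [y] at negative times. *)
Definition prox_saddle_flow (R : realType) (n m : nat)
    (S : 'rV[R]_n -> 'rV[R]_m -> R) (rho : R)
    (u : R -> 'rV[R]_n) (y : R -> 'rV[R]_m) : Prop :=
  [/\ {within `[0, +oo[, continuous u},
      {within `[0, +oo[, continuous y},
      forall t : R, 0 < t ->
        is_derive t 1 u (- grad1 (Stilde S rho) (u t) (y t))
    & forall t : R, 0 < t ->
        is_derive t 1 y (grad2 (Stilde S rho) (u t) (y t))].

(* Main.v *)
From HB Require Import structures.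
From mathcomp Require Import ring lra.
Require Import Defs.

(** Let V be the squared distance from the trajectory z = (u, y) to a saddle point
of S, and x the minimizer at z. The gradient inequalities of S at (x, y), where
the x-gradient is rho (u - x), give V' <= -2 rho |u - x|^2, so V is
nonincreasing. Moreover W = rho V - Stilde satisfies W' <= -|z'|^2 and is bounded
below, hence |z'| gets arbitrarily small at arbitrarily late times. Along such
times the bounded trajectory has a cluster point, which by continuity is an
equilibrium, that is, a saddle point of S; as the distance to it is also
nonincreasing, the whole trajectory converges to it.

Stilde is continuously differentiable because testing the minimum at q with the
minimizer at p bounds Stilde q - Stilde p above by the candidate differential at
p plus O(|q - p|^2); exchanging p and q gives the lower bound, and the candidate
gradient is continuous. *)

(** * The Euclidean inner product and its comparison with the sup norm *)

Section DotProduct.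
Context {R : realType} {n : nat}.
Implicit Types u v w : 'rV[R]_n.

Definition dotv u v : R := \sum_(i < n) u 0 i * v 0 i.

Lemma sqnormE u : sqnorm u = dotv u u.
Proof. by apply: eq_bigr => i _; rewrite expr2. Qed.

Lemma dotvC u v : dotv u v = dotv v u.
Proof. by apply: eq_bigr => i _; rewrite mulrC. Qed.

Lemma dotv_linear u : linear (dotv u : 'rV[R]_n -> R^o).
Proof.
move=> a v w; rewrite /dotv scaler_sumr -big_split /=; apply: eq_bigr => i _.
by rewrite !mxE mulrDr mulrCA.
Qed.

HB.instance Definition _ u :=
  GRing.isLinear.Build R 'rV[R]_n R^o *:%R (dotv u) (dotv_linear u).

Lemma dotvDr u v w : dotv u (v + w) = dotv u v + dotv u w.
Proof. exact: linearD. Qed.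

Lemma dotvNr u v : dotv u (- v) = - dotv u v.
Proof. exact: linearN. Qed.

Lemma dotvZr u a v : dotv u (a *: v) = a * dotv u v.
Proof. exact: (linearZ_LR (dotv u)). Qed.

Lemma dotvDl u v w : dotv (v + w) u = dotv v u + dotv w u.
Proof. by rewrite !(dotvC _ u) dotvDr. Qed.

Lemma dotvNl u v : dotv (- v) u = - dotv v u.
Proof. by rewrite !(dotvC _ u) dotvNr. Qed.

Lemma dotvZl u a v : dotv (a *: v) u = a * dotv v u.
Proof. by rewrite !(dotvC _ u) dotvZr. Qed.

Definition dotvE := (dotvDr, dotvDl, dotvNr, dotvNl, dotvZr, dotvZl).

Lemma sqnorm_ge0 u : 0 <= sqnorm u.
Proof. by apply: sumr_ge0 => i _; rewrite sqr_ge0. Qed.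

Lemma sqnorm0 : sqnorm (0 : 'rV[R]_n) = 0.
Proof. by rewrite /sqnorm big1 // => i _; rewrite mxE expr0n. Qed.

Lemma coord_le_norm u i : `|u 0 i| <= `|u|.
Proof.
rewrite [leRHS]mx_normrE.
exact: (le_bigmax _ (fun ij : 'I_1 * 'I_n => `|u ij.1 ij.2|) (0, i)).
Qed.

(** The sup norm is attained at some coordinate, whose square is one term of the sum. *)
Lemma norm_sqr_le_sqnorm u : `|u| ^+ 2 <= sqnorm u.
Proof.
have [u0|] := eqVneq `|u| 0; first by rewrite u0 expr0n sqnorm_ge0.
move=> /mx_norm_neq0[[i j] /= uij]; rewrite [`|u|]uij.
rewrite (ord1 i) real_normK ?num_real // /sqnorm (bigD1 j) //= lerDl.
by apply: sumr_ge0 => k _; rewrite sqr_ge0.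
Qed.

Lemma dotv_le_norm u v : `|dotv u v| <= n%:R * (`|u| * `|v|).
Proof.
apply: le_trans (ler_norm_sum _ _ _) _.
apply: (@le_trans _ _ (\sum_(i < n) `|u| * `|v|)).
  by apply: ler_sum => i _; rewrite normrM ler_pM ?coord_le_norm.
by rewrite sumr_const card_ord mulr_natl.
Qed.

Lemma sqnorm_eq0 u : (sqnorm u == 0) = (u == 0).
Proof.
apply/eqP/eqP => [u0|->]; last exact: sqnorm0.
apply/eqP; rewrite -normr_eq0 -sqrf_eq0 eq_le sqr_ge0 andbT -u0.
exact: norm_sqr_le_sqnorm.
Qed.

(** Testing with [w := u - v] makes [sqnorm (u - v)] vanish. *)
Lemma dotv_inj u v : (forall w, dotv u w = dotv v w) -> u = v.
Proof.
move=> uv; apply/eqP; rewrite -subr_eq0 -sqnorm_eq0 sqnormE dotvDl dotvNl.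
by rewrite uv subrr.
Qed.

Lemma continuous_dotvr u : continuous (dotv u).
Proof.
move=> v; apply: (@cvg_big R^o _ _ _ _ (@add_continuous R^o) _ (nbhs v)) => i _.
by apply: cvgM; [exact: cvg_cst | exact: coord_continuous].
Qed.

Lemma continuous_sqnorm : continuous (@sqnorm R n).
Proof.
move=> v; apply: (@cvg_big R^o _ _ _ _ (@add_continuous R^o) _ (nbhs v)) => i _.
by rewrite expr2; apply: cvgM; exact: coord_continuous.
Qed.

(** Turns Euclidean estimates into convergence for the topology, which comes from the sup norm. *)
Lemma cvg_sqnorm_norm {T : Type} {F : set_system T} {FF : Filter F}
    (f : T -> 'rV[R]_n) (l : 'rV[R]_n) :
  (forall e, 0 < e -> \forall t \near F, sqnorm (f t - l) < e) -> f t @[t --> F] --> l.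
Proof.
move=> fl; apply/cvgrPdist_lt => e e0; near=> t.
rewrite distrC -(ltr_pXn2r (n := 2)) ?nnegrE ?(ltW e0) //.
apply: le_lt_trans (norm_sqr_le_sqnorm _) _; near: t; apply: fl.
by rewrite exprn_gt0.
Unshelve. all: by end_near. Qed.

End DotProduct.

(** * Gradients, one-sided difference quotients and convexity *)

Section Gradient.
Context {R : realType} {n : nat}.
Implicit Types (f : 'rV[R]_n -> R) (x v z : 'rV[R]_n).

Lemma derive_dotv_grad f x v : differentiable f x -> 'D_v f x = dotv (grad f x) v.
Proof.
move=> dfx; rewrite deriveE // [in LHS](row_sum_delta v) linear_sum.
apply: eq_bigr => i _; rewrite linearZ /= mxE deriveE //.
by rewrite mulrC.
Qed.

Lemma grad_is_diff f x g : is_diff x f (dotv g) -> grad f x = g.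
Proof.
move=> dfx; apply: dotv_inj => w; rewrite -derive_dotv_grad //.
by rewrite deriveE // diff_val.
Qed.

(** The term [h * K] leaves room for a second-order error: it vanishes as [h] tends to 0 from the
    right, while the quotient tends to the directional derivative. *)
Lemma derive_le f x v c K : differentiable f x ->
  (forall h, 0 < h -> h <= 1 -> f (h *: v + x) - f x <= h * (c + h * K)) ->
  'D_v f x <= c.
Proof.
move=> dfx fle.
have dfv : derivable f x v by exact: diff_derivable.
have cK : c + h * K @[h --> 0^'+] --> c.
  have : c + h * K @[h --> (0 : R)] --> c + 0 * K.
    by apply: cvgD; [exact: cvg_cst | apply: cvgMl; exact: cvg_id].
  by rewrite mul0r addr0 => /cvg_at_right_filter.
have dcvg : h^-1 *: (f (h *: v + x) - f x) @[h --> 0^'+] --> ('D_v f x : R^o).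
  apply: cvg_trans dfv; apply: cvg_app.
  by move=> A [e e0 Ae]; exists e => // h he h0; apply: Ae => //; rewrite gt_eqF.
apply: ler_cvg_to dcvg cK _; near=> h.
have h0 : 0 < h by [].
rewrite -[_ *: _]/(h^-1 * _) ler_pdivrMl //; apply: fle => //.
by near: h; exact: nbhs_right_le.
Unshelve. all: by end_near. Qed.

(** Convexity on the segment from [x] to [z] bounds each difference quotient in direction [z - x] by
    [f z - f x]. *)
Lemma convex_gradient_le f x z : convex_function setT f -> differentiable f x ->
  f x + dotv (grad f x) (z - x) <= f z.
Proof.
move=> fcvx dfx; rewrite -lerBrDl -derive_dotv_grad //.
apply: (@derive_le _ _ _ _ 0) => // h h0 h1.
have : f (h *: z + (1 - h) *: x) <= h * f z + (1 - h) * f x.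
  exact: (fcvx (Itv01 (ltW h0) h1) z x (mem_setT _) (mem_setT _)).
rewrite (_ : h *: z + (1 - h) *: x = h *: (z - x) + x); first by lra.
by rewrite scalerBl scale1r scalerBr addrCA addrC.
Qed.

Lemma derive_ge f x v c K : differentiable f x ->
  (forall h, 0 < h -> h <= 1 -> h * (c + h * K) <= f (h *: v + x) - f x) ->
  c <= 'D_v f x.
Proof.
move=> dfx fge; rewrite -[leLHS]opprK lerNl -deriveN; last exact: diff_derivable.
apply: (@derive_le _ _ _ _ (- K)) => [|h h0 h1]; first exact: differentiableN.
by have := fge h h0 h1; rewrite !opprfctE; lra.
Qed.

End Gradient.

(** * Differentials obtained from explicit remainder bounds *)

Section DifferentialOfEstimate.
Context {R : realType} {V : normedModType R}.

(** The candidate [df] is a bare function, so that explicit formulas can be supplied; it is packed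
    as a linear map only to invoke uniqueness of the differential. *)
Lemma is_diff_of_estimate (f df : V -> R) p :
  linear (df : V -> R^o) -> continuous df ->
  (forall e, 0 < e -> \forall q \near p, `|f q - f p - df (q - p)| <= e * `|q - p|) ->
  is_diff p f df.
Proof.
move=> df_lin df_cont f_est.
pose lin := GRing.isLinear.Build R V R^o *:%R df df_lin.
pose g : {linear V -> R^o} := HB.pack df lin.
have g_est : f \o shift p = cst (f p) + g +o_ 0 id.
  apply/eqaddoP => e e0.
  have := f_est e e0; rewrite (near_shift 0).
  apply: filterS => h /=.
  rewrite subr0 addrK opprD addrA; exact.
have dg : 'd f p = g :> (V -> R^o) by exact: diff_unique.
split; last by rewrite dg.
apply/diff_locallyP; rewrite dg; split => //.
Qed.

Lemma is_diff_of_modulus (f df c : V -> R) p :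
  linear (df : V -> R^o) -> continuous df -> c q @[q --> p] --> (0 : R) ->
  (forall q, `|f q - f p - df (q - p)| <= c q * `|q - p|) -> is_diff p f df.
Proof.
move=> df_lin df_cont c0 f_est; apply: is_diff_of_estimate => // e e0.
have /cvgrPdist_le /(_ e e0) := c0; apply: filterS => q.
rewrite sub0r normrN => cqe; apply: le_trans (f_est q) _.
by apply: ler_wpM2r => //; apply: le_trans (ler_norm _) cqe.
Qed.

Lemma continuous_center (p : V) : continuous (fun q => q - p).
Proof. by move=> q; apply: cvgB; [exact: cvg_id | exact: cvg_cst]. Qed.

Lemma cvg_norm_center {W : normedModType R} (K : R) (g : V -> W) p :
  {for p, continuous g} -> K * `|g q - g p| @[q --> p] --> (0 : R).
Proof.
move=> g_cont; have : K * `|g q - g p| @[q --> p] --> K * `|g p - g p|.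
  by apply: cvgMl_tmp; apply: cvg_norm; apply: cvgB => //; exact: cvg_cst.
by rewrite subrr normr0 mulr0.
Qed.

End DifferentialOfEstimate.

(** * The squared norm: expansions, differential, compact balls *)

Section SquaredNorm.
Context {R : realType} {n : nat}.
Implicit Types p q : 'rV[R]_n.

Lemma sqnorm_le_norm p : sqnorm p <= n%:R * (`|p| * `|p|).
Proof. by rewrite sqnormE; apply: le_trans (ler_norm _) (dotv_le_norm p p). Qed.

Lemma sqnormD p q : sqnorm (p + q) = sqnorm p + 2 * dotv p q + sqnorm q.
Proof. by rewrite !sqnormE !dotvE (dotvC q p); ring. Qed.

Lemma sqnormN p : sqnorm (- p) = sqnorm p.
Proof. by rewrite !sqnormE !dotvE opprK. Qed.

Lemma sqnormZ a p : sqnorm (a *: p) = a ^+ 2 * sqnorm p.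
Proof. by rewrite !sqnormE !dotvE mulrA. Qed.

Lemma sqnormB p q : sqnorm (p - q) = sqnorm p - 2 * dotv p q + sqnorm q.
Proof. by rewrite sqnormD sqnormN dotvNr; ring. Qed.

(** The remainder is exactly [sqnorm (q - p)], at most [n] times the squared sup norm. *)
Lemma is_diff_sqnorm p : is_diff p (@sqnorm R n) (dotv (2 *: p)).
Proof.
apply: (@is_diff_of_modulus _ _ _ _ (fun q => n%:R * `|q - p|)).
- exact: dotv_linear.
- exact: continuous_dotvr.
- exact: (@cvg_norm_center _ _ _ _ id).
- move=> q; rewrite -mulrA.
  suff -> : sqnorm q - sqnorm p - dotv (2 *: p) (q - p) = sqnorm (q - p).
    by rewrite ger0_norm ?sqnorm_ge0 // sqnorm_le_norm.
  by rewrite sqnormB dotvZl !dotvE -!sqnormE (dotvC q p); ring.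
Qed.

Lemma continuous_sqnorm_center p : continuous (fun q => sqnorm (q - p)).
Proof.
move=> q; apply: (@continuous_comp _ _ _ (fun q => q - p) (@sqnorm R n)).
  exact: continuous_center.
exact: continuous_sqnorm.
Qed.

Lemma compact_sqnorm_ball p r : compact [set q | sqnorm (q - p) <= r].
Proof.
apply: bounded_closed_compact.
  (* From [t ^+ 2 <= r] follows [t <= 1 + r], a bound without square roots. *)
  exists (`|p| + (1 + r)); split; first exact: num_real.
  move=> M ltM q /= q_r; apply: le_trans (ltW ltM).
  rewrite -[q in `|q|](subrK p) addrC; apply: le_trans (ler_normD _ _) _.
  rewrite lerD2l; have := norm_sqr_le_sqnorm (q - p).
  by have := normr_ge0 (q - p); nra.
apply: (preimage_closed _ (@closed_le _ r)) => q _; exact: continuous_sqnorm_center.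
Qed.

End SquaredNorm.

Lemma continuous_sqnormD {R : realType} {T : topologicalType} {n m : nat}
    (f : T -> 'rV[R]_n) (g : T -> 'rV[R]_m) :
  continuous f -> continuous g -> continuous (fun q => sqnorm (f q) + sqnorm (g q)).
Proof.
move=> f_cont g_cont q.
apply: (@continuousD _ _ _ (fun q => sqnorm (f q)) (fun q => sqnorm (g q))).
  by apply: (@continuous_comp _ _ _ f (@sqnorm R n));
    [exact: f_cont | exact: continuous_sqnorm].
by apply: (@continuous_comp _ _ _ g (@sqnorm R m));
  [exact: g_cont | exact: continuous_sqnorm].
Qed.

(** * Chain rule and mean value estimate along curves *)

Section Curves.
Context {R : realType} {V : normedModType R}.

Lemma is_derive_comp_diff (f df : V -> R) (g : R -> V) (t : R) (g' : V) :
  is_derive t 1 g g' -> is_diff (g t) f df -> is_derive t 1 (f \o g) (df g').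
Proof.
move=> dg dfg; have dgt : differentiable g t by apply/derivable1_diffP; exact: ex_derive.
have dfgt : differentiable (f \o g) t by apply: differentiable_comp => //; exact: ex_diff.
split; first exact: diff_derivable.
have dg1 : 'd g t 1 = g' by rewrite -deriveE // derive_val.
by rewrite deriveE // diff_comp //= dg1 diff_val.
Qed.

Lemma is_derive_pair {W : normedModType R} (g : R -> V) (h : R -> W) (t : R)
    (g' : V) (h' : W) :
  is_derive t 1 g g' -> is_derive t 1 h h' ->
  is_derive t 1 (fun s => (g s, h s)) (g', h').
Proof.
move=> dg dh; have dgt : differentiable g t by apply/derivable1_diffP; exact: ex_derive.
have dht : differentiable h t by apply/derivable1_diffP; exact: ex_derive.
have dght : differentiable (fun s => (g s, h s)) t by exact: differentiable_pair.
split; first exact: diff_derivable.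
have dg1 : 'd g t 1 = g' by rewrite -deriveE // derive_val.
have dh1 : 'd h t 1 = h' by rewrite -deriveE // derive_val.
by rewrite deriveE // diff_pair //= dg1 dh1.
Qed.

Lemma derive_le_increment (f df : R -> R) (k a b : R) : a <= b ->
  (forall t, a <= t -> t <= b -> is_derive t 1 f (df t)) ->
  (forall t, a <= t -> t <= b -> df t <= k) -> f b - f a <= k * (b - a).
Proof.
move=> ab f_df df_le.
have [t||c] := @MVT_segment R f df a b ab; rewrite ?in_itv /=.
- by move=> /andP[/ltW ? /ltW ?]; exact: f_df.
- apply: derivable_within_continuous => t; rewrite in_itv /= => /andP[? ?].
  by apply: ex_derive; exact: f_df.
- move=> /andP[? ?] ->; apply: ler_wpM2r; first by rewrite subr_ge0.
  exact: df_le.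
Qed.

End Curves.

(** * Gradient inequalities for convex-concave functions *)

Section PartialGradients.
Context {R : realType} {n m : nat} {S : 'rV[R]_n -> 'rV[R]_m -> R}.
Hypothesis S_C1 : continuously_differentiable S.

Lemma differentiable_section1 x y : differentiable (S ^~ y) x.
Proof.
have [dS _ _] := S_C1.
exact: (@differentiable_comp _ _ _ _ (fun z => (z, y)) (fun q => S q.1 q.2)).
Qed.

Lemma differentiable_section2 x y : differentiable (S x) y.
Proof.
have [dS _ _] := S_C1.
exact: (@differentiable_comp _ _ _ _ (fun z => (x, z)) (fun q => S q.1 q.2)).
Qed.

Hypothesis S_cc : convex_concave S.

Lemma grad1_le x y z : S x y + dotv (grad1 S x y) (z - x) <= S z y.
Proof.
by apply: convex_gradient_le; [exact: (S_cc.1 y) | exact: differentiable_section1].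
Qed.

Lemma grad2_ge x y z : S x z <= S x y + dotv (grad2 S x y) (z - y).
Proof.
have dSx := differentiable_section2 x y.
have := @convex_gradient_le _ _ (fun y => - S x y) y z (S_cc.2 x) (differentiableN dSx).
rewrite -derive_dotv_grad; last exact: differentiableN.
rewrite deriveN; last exact: diff_derivable.
by rewrite derive_dotv_grad // -/(grad2 S x y); lra.
Qed.

(** Sum of the two gradient inequalities between [x] and [z]. *)
Lemma grad1_monotone x z y :
  0 <= dotv (grad1 S z y - grad1 S x y) (z - x).
Proof.
have := grad1_le x y z; have := grad1_le z y x.
by rewrite -(opprB z x) !dotvE; lra.
Qed.

Lemma saddle_point_grad0 x y : grad1 S x y = 0 -> grad2 S x y = 0 ->
  saddle_point S x y.
Proof.
move=> g1 g2 x' y'; have := grad1_le x y x'; have := grad2_ge x y y'.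
by rewrite g1 g2 !(dotvC 0) !linear0 !addr0.
Qed.

End PartialGradients.

(** * The proximal minimizer: existence, optimality, uniqueness, continuity *)

Section Proximal.
Context {R : realType} {n m : nat} {S : 'rV[R]_n -> 'rV[R]_m -> R} {rho : R}.
Hypothesis S_cc : convex_concave S.
Hypothesis S_C1 : continuously_differentiable S.
Hypothesis rho_gt0 : 0 < rho.

Local Notation F := (prox_objective S rho).
Local Notation X := (xtilde S rho).

(** With [g] the x-gradient at [u] and [d = x - u], the gradient inequality gives
    [rho / 2 |d|^2 + <g, d> <= 0]; combining this with [|2 g + rho d|^2 >= 0] eliminates [<g, d>].
    The sublevel set of [u] thus lies in a compact ball. *)
Lemma prox_objective_sublevel u y x : F u y x <= F u y u ->
  sqnorm (x - u) <= 4 / rho ^+ 2 * sqnorm (grad1 S u y).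
Proof.
rewrite /prox_objective subrr sqnorm0 mulr0 addr0 => Fle.
have Sge := grad1_le S_C1 S_cc u y x.
have := sqnorm_ge0 (2 *: grad1 S u y + rho *: (x - u)).
rewrite (sqnormD (2 *: _)) !sqnormZ dotvZl dotvZr => sq_ge0.
rewrite mulrAC ler_pdivlMr ?exprn_gt0 //.
have : rho * (rho / 2 * sqnorm (x - u) + dotv (grad1 S u y) (x - u)) <= 0.
  by rewrite pmulr_rle0 //; lra.
by lra.
Qed.

Lemma minimizer_prox_exists u y : minimizer (F u y) !=set0.
Proof.
pose r := 4 / rho ^+ 2 * sqnorm (grad1 S u y).
pose A : set 'rV[R]_n := [set x | sqnorm (x - u) <= r].
have Au : A u.
  by rewrite /A /= subrr sqnorm0 mulr_ge0 ?sqnorm_ge0 // divr_ge0 // exprn_ge0 // ltW.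
have F_cont : {within A, continuous (F u y)}.
  apply: continuous_subspaceT => x.
  apply: (@continuousD _ _ _ (S ^~ y) (fun x => rho / 2 * sqnorm (x - u))).
    exact: differentiable_continuous (differentiable_section1 S_C1 x y).
  apply: (@continuousM _ _ (cst (rho / 2))); first exact: cst_continuous.
  exact: continuous_sqnorm_center.
have [||c /set_mem Ac c_min] := @EVT_min_rV _ _ (F u y) A _ _ F_cont.
- by exists u.
- exact: compact_sqnorm_ball.
(* Outside the ball the objective is at least its value at [u], so the minimum on the ball is
   global. *)
exists c => z; have [/mem_set/c_min //|nAz] := pselect (A z).
apply: le_trans (c_min _ (mem_set Au)) _; rewrite leNgt; apply/negP => Fz.
exact/nAz/prox_objective_sublevel/ltW.
Qed.

Lemma minimizer_prox_grad u y p : minimizer (F u y) p ->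
  grad1 S p y = rho *: (u - p).
Proof.
move=> p_min.
have dir v : dotv (rho *: (u - p)) v <= dotv (grad1 S p y) v.
  have dSp := differentiable_section1 S_C1 p y.
  rewrite -(derive_dotv_grad v dSp).
  (* The constant is the second-order part of the proximal term along [v], moved to the other side
     of the minimality inequality. *)
  apply: (@derive_ge _ _ _ _ _ _ (- (rho / 2 * sqnorm v))) => // h h0 h1.
  have := p_min (h *: v + p); rewrite /prox_objective.
  have -> : sqnorm (h *: v + p - u) =
      h ^+ 2 * sqnorm v + 2 * h * dotv v (p - u) + sqnorm (p - u).
    by rewrite -(addrA (h *: v)) (sqnormD (h *: v)) sqnormZ dotvZl; ring.
  by rewrite dotvZl -(opprB p u) dotvNl (dotvC _ v); lra.
apply: dotv_inj => v; apply/eqP; rewrite eq_le dir andbT.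
by have := dir (- v); rewrite !dotvNr lerN2.
Qed.

(** Expanding [sqnorm (z - u)] around [p] produces a cross term that cancels against the linear term
    of the gradient inequality. The quadratic gain yields uniqueness of the minimizer. *)
Lemma prox_objective_strong u y p z : grad1 S p y = rho *: (u - p) ->
  F u y p + rho / 2 * sqnorm (z - p) <= F u y z.
Proof.
move=> gp; have := grad1_le S_C1 S_cc p y z; rewrite gp /prox_objective.
have -> : sqnorm (z - u) = sqnorm (z - p) - 2 * dotv (u - p) (z - p) + sqnorm (p - u).
  by rewrite -[sqnorm (p - u)]sqnormN opprB (dotvC _ (z - p)) -sqnormB opprB addrA subrK.
by rewrite dotvZl; lra.
Qed.

(** Existence ensures that [get] returns an actual minimizer and not its default value. *)
Lemma minimizer_xtilde u y : minimizer (F u y) (X u y).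
Proof. by have [x x_min] := minimizer_prox_exists u y; exact: getI x_min. Qed.

Lemma grad1_xtilde u y : grad1 S (X u y) y = rho *: (u - X u y).
Proof. exact/minimizer_prox_grad/minimizer_xtilde. Qed.

Lemma minimizer_prox_uniq u y : minimizer (F u y) = [set X u y].
Proof.
apply/seteqP; split=> [x x_min|_ ->]; last exact: minimizer_xtilde.
have := prox_objective_strong x (grad1_xtilde u y); have := x_min (X u y).
move=> xle leX; apply/eqP; rewrite -subr_eq0 -sqnorm_eq0 eq_le sqnorm_ge0 andbT.
rewrite -(@pmulr_rle0 _ (rho / 2)) ?divr_gt0 //.
by lra.
Qed.

Lemma Stilde_xtilde u y : Stilde S rho u y = F u y (X u y).
Proof.
apply/eqP; rewrite eq_le; apply/andP; split.
  apply: ge_inf; last by exists (X u y).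
  by exists (F u y (X u y)) => _ [z _ <-]; exact: minimizer_xtilde.
apply: lb_le_inf; first by exists (F u y u); exists u.
by move=> _ [z _ <-]; exact: minimizer_xtilde.
Qed.

Lemma Stilde_le u y x : Stilde S rho u y <= F u y x.
Proof. by rewrite Stilde_xtilde; exact: minimizer_xtilde. Qed.

(* This is strong monotonicity of the gradient of the prox objective, combined
   with [w^2 - 2 rho <w, e> + rho^2 e^2 >= 0]. With [x] the
   minimizer at a fixed point, it gives the continuity of [xtilde] there. *)
Lemma xtilde_dist u y x :
  rho ^+ 2 * sqnorm (X u y - x) <= sqnorm (rho *: (u - x) - grad1 S x y).
Proof.
set w := _ - grad1 S x y; set e := X u y - x.
have we : rho * sqnorm e <= dotv w e.
  have := grad1_monotone S_C1 S_cc x (X u y) y; rewrite grad1_xtilde -/e.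
  have -> : rho *: (u - X u y) - grad1 S x y = w - rho *: e.
    by rewrite /w /e addrAC -scalerBr opprB addrA subrK.
  by rewrite dotvDl dotvNl dotvZl -sqnormE subr_ge0.
have := sqnorm_ge0 (w - rho *: e); rewrite sqnormB sqnormZ dotvZr.
by have := ler_wpM2l (ltW rho_gt0) we; lra.
Qed.

Lemma continuous_xtilde :
  continuous (fun q : 'rV[R]_n * 'rV[R]_m => X q.1 q.2).
Proof.
move=> q0; set x := X q0.1 q0.2.
have [_ g1_cont _] := S_C1.
(* The right-hand side of [xtilde_dist] with [x] frozen at [q0]: it is continuous in [q], and
   vanishes at [q0] by the optimality condition. *)
pose b (q : 'rV[R]_n * 'rV[R]_m) := rho *: (q.1 - x) - grad1 S x q.2.
have b_cont : continuous (fun q => sqnorm (b q)).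
  move=> q; apply: (@continuous_comp _ _ _ b (@sqnorm R n));
    last exact: continuous_sqnorm.
  apply: (@continuousB _ _ _ (fun q : 'rV[R]_n * 'rV[R]_m => rho *: (q.1 - x))
    (fun q => grad1 S x q.2)).
    apply: (@continuous_comp _ _ _ (fun q : 'rV[R]_n * 'rV[R]_m => q.1 - x) ( *:%R rho));
      last exact: scaler_continuous.
    apply: (@continuousB _ _ _ (fun q : 'rV[R]_n * 'rV[R]_m => q.1) (cst x)).
      exact: cvg_fst.
    exact: cst_continuous.
  apply: (@continuous_comp _ _ _ (fun q : 'rV[R]_n * 'rV[R]_m => (x, q.2))
    (fun q => grad1 S q.1 q.2)); last exact: g1_cont.
  by apply: (@cvg_pair _ _ _ (nbhs q) (nbhs x) (nbhs q.2));
    [exact: cvg_cst | exact: cvg_snd].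
have b0 : sqnorm (b q0) = 0 by rewrite /b -grad1_xtilde subrr sqnorm0.
apply: cvg_sqnorm_norm => e e0.
have /cvgr_lt /(_ (rho ^+ 2 * e)) := b_cont q0.
rewrite b0 mulr_gt0 ?exprn_gt0 // => /(_ isT); apply: filterS => q bq.
rewrite -(ltr_pM2l (exprn_gt0 2 rho_gt0)).
exact: le_lt_trans (xtilde_dist _ _ _) bq.
Qed.

End Proximal.

(** * Continuous differentiability of the proximal envelope *)

Section StildeDifferential.
Context {R : realType} {n m : nat} {S : 'rV[R]_n -> 'rV[R]_m -> R} {rho : R}.
Hypothesis S_cc : convex_concave S.
Hypothesis S_C1 : continuously_differentiable S.
Hypothesis rho_gt0 : 0 < rho.
Implicit Types p q : 'rV[R]_n * 'rV[R]_m.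

Local Notation X := (xtilde S rho).
Local Notation G1 p := (rho *: (p.1 - X p.1 p.2)).
Local Notation G2 p := (grad2 S (X p.1 p.2) p.2).

(** The minimizer at [p] is a competitor at [q]. Concavity linearizes the change in [y] with no
    error term; the quadratic error comes from expanding the proximal square around [p.1]. *)
Lemma Stilde_increment_le p q :
  Stilde S rho q.1 q.2 - Stilde S rho p.1 p.2 <=
    dotv (G1 p) (q.1 - p.1) + dotv (G2 p) (q.2 - p.2) + rho / 2 * sqnorm (q.1 - p.1).
Proof.
have := Stilde_le S_cc S_C1 rho_gt0 q.1 q.2 (X p.1 p.2).
have := grad2_ge S_C1 S_cc (X p.1 p.2) p.2 q.2.
rewrite (Stilde_xtilde S_cc S_C1 rho_gt0 p.1) /prox_objective.
set x := X p.1 p.2; have -> : sqnorm (x - q.1) =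
    sqnorm (x - p.1) + 2 * dotv (p.1 - x) (q.1 - p.1) + sqnorm (q.1 - p.1).
  have -> : x - q.1 = (x - p.1) - (q.1 - p.1) by rewrite opprB addrA subrK.
  by rewrite sqnormB -(opprB p.1 x) dotvNl; ring.
by rewrite dotvZl; lra.
Qed.

Lemma continuous_proxgrad1 : continuous (fun p => G1 p).
Proof.
move=> p; apply: (@continuous_comp _ _ _ (fun p => p.1 - X p.1 p.2) ( *:%R rho));
  last exact: scaler_continuous.
apply: (@continuousB _ _ _ (fun q : 'rV[R]_n * 'rV[R]_m => q.1)
  (fun q => X q.1 q.2)); first exact: cvg_fst.
exact: continuous_xtilde.
Qed.

Lemma continuous_proxgrad2 : continuous (fun p => G2 p).
Proof.
have [_ _ g2_cont] := S_C1; move=> p.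
apply: (@continuous_comp _ _ _ (fun q => (X q.1 q.2, q.2))
  (fun q => grad2 S q.1 q.2)); last exact: g2_cont.
apply: (@cvg_pair _ _ _ (nbhs p) (nbhs (X p.1 p.2)) (nbhs p.2)); last exact: cvg_snd.
exact: continuous_xtilde.
Qed.

Lemma is_diff_Stilde p : is_diff p (fun q => Stilde S rho q.1 q.2)
  (fun v => dotv (G1 p) v.1 + dotv (G2 p) v.2).
Proof.
(* The first two terms pay for replacing the gradients at [q] by those at [p] in the lower bound,
   the third for the quadratic error; [n] and [m] come from [dotv_le_norm] and [sqnorm_le_norm]. *)
pose c q := n%:R * `|G1 q - G1 p| + m%:R * `|G2 q - G2 p| + rho / 2 * n%:R * `|q - p|.
apply: (@is_diff_of_modulus _ _ _ _ c).
- by move=> a v w /=; rewrite !dotvDr !dotvZr /GRing.scale /=; ring.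
- move=> v; apply: (@continuousD _ _ _ (fun v : 'rV[R]_n * 'rV[R]_m => dotv (G1 p) v.1)
    (fun v => dotv (G2 p) v.2)).
    by apply: (@continuous_comp _ _ _ fst (dotv (G1 p)));
      [exact: cvg_fst | exact: continuous_dotvr].
  by apply: (@continuous_comp _ _ _ snd (dotv (G2 p)));
    [exact: cvg_snd | exact: continuous_dotvr].
- have c1 := @cvg_norm_center _ _ _ n%:R (fun p => G1 p) p (@continuous_proxgrad1 p).
  have c2 := @cvg_norm_center _ _ _ m%:R (fun p => G2 p) p (@continuous_proxgrad2 p).
  have c3 := @cvg_norm_center _ _ _ (rho / 2 * n%:R) id p (fun _ => id).
  have := cvgD (cvgD c1 c2) c3; rewrite !addr0. exact.
- move=> q.
  have d1 : `|q.1 - p.1| <= `|q - p| by rewrite prod_normE le_max lexx.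
  have d2 : `|q.2 - p.2| <= `|q - p| by rewrite prod_normE le_max lexx orbT.
  have sq_le : sqnorm (q.1 - p.1) <= n%:R * (`|q - p| * `|q - p|).
    by apply: le_trans (sqnorm_le_norm _) _; rewrite ler_wpM2l // ler_pM.
  have dot_ge k (g d : 'rV[R]_k) r : `|d| <= r -> - (k%:R * (`|g| * r)) <= dotv g d.
    move=> dr; have := dotv_le_norm g d; rewrite ler_norml => /andP[+ _].
    by apply: le_trans; rewrite lerN2 ler_wpM2l // ler_wpM2l.
  have e1 := dot_ge _ (G1 q - G1 p) _ _ d1.
  have e2 := dot_ge _ (G2 q - G2 p) _ _ d2.
  have up := Stilde_increment_le p q; have low := Stilde_increment_le q p.
  rewrite /= -(opprB q.1) -(opprB q.2) sqnormN !dotvNr in low.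
  rewrite dotvDl dotvNl in e1; rewrite dotvDl dotvNl in e2.
  have rho2_ge0 : 0 <= rho / 2 by rewrite divr_ge0 // ltW.
  have quad := ler_wpM2l rho2_ge0 sq_le.
  (* The upper bound has only the quadratic error; these signs let it fit under the same modulus. *)
  have c1 : 0 <= n%:R * (`|G1 q - G1 p| * `|q - p|) by rewrite !mulr_ge0.
  have c2 : 0 <= m%:R * (`|G2 q - G2 p| * `|q - p|) by rewrite !mulr_ge0.
  rewrite ler_norml /c; apply/andP; split; lra.
Qed.

Lemma grad1_Stilde u y : grad1 (Stilde S rho) u y = rho *: (u - X u y).
Proof.
apply: grad_is_diff; have dM := is_diff_Stilde (u, y).
have dpair : is_diff u (fun z : 'rV[R]_n => (z, y)) (fun v => (v, 0)).
  exact: (is_diff_pair (is_diff_id _) (is_diff_cst _ _)).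
apply: is_diff_eq (is_diff_comp dpair dM) _.
by apply/funext => v /=; rewrite linear0 addr0.
Qed.

Lemma grad2_Stilde u y : grad2 (Stilde S rho) u y = grad2 S (X u y) y.
Proof.
apply: grad_is_diff; have dM := is_diff_Stilde (u, y).
have dpair : is_diff y (fun z : 'rV[R]_m => (u, z)) (fun v => (0, v)).
  exact: (is_diff_pair (is_diff_cst _ _) (is_diff_id _)).
apply: is_diff_eq (is_diff_comp dpair dM) _.
by apply/funext => v /=; rewrite linear0 add0r.
Qed.

Lemma continuously_differentiable_Stilde : continuously_differentiable (Stilde S rho).
Proof.
split=> [p||]; first by have [] := is_diff_Stilde p.
  by under eq_fun do rewrite grad1_Stilde; exact: continuous_proxgrad1.
by under eq_fun do rewrite grad2_Stilde; exact: continuous_proxgrad2.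
Qed.

End StildeDifferential.

(** * Saddle points of [S] and of its envelope, and equilibria of the flow *)

Section SaddleFlow.
Context {R : realType} {n m : nat} {S : 'rV[R]_n -> 'rV[R]_m -> R} {rho : R}.
Hypothesis S_cc : convex_concave S.
Hypothesis S_C1 : continuously_differentiable S.
Hypothesis rho_gt0 : 0 < rho.

Local Notation X := (xtilde S rho).

Lemma Stilde_le_self u y : Stilde S rho u y <= S u y.
Proof.
apply: le_trans (Stilde_le S_cc S_C1 rho_gt0 u y u) _.
by rewrite /prox_objective subrr sqnorm0 mulr0 addr0.
Qed.

Lemma Stilde_ge_lower_bound c u y : (forall x, c <= S x y) -> c <= Stilde S rho u y.
Proof.
move=> c_le; rewrite (Stilde_xtilde S_cc S_C1 rho_gt0); apply: le_trans (c_le (X u y)) _.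
by rewrite lerDl mulr_ge0 ?sqnorm_ge0 // divr_ge0 // ltW.
Qed.

(** The envelope lies below [S] and keeps lower bounds that are uniform in [x], so both functions
    agree at the saddle point and its two inequalities carry over. *)
Lemma saddle_point_Stilde us ys : saddle_point S us ys ->
  saddle_point (Stilde S rho) us ys.
Proof.
move=> sad.
have valE : Stilde S rho us ys = S us ys.
  apply/eqP; rewrite eq_le Stilde_le_self /=.
  by apply: Stilde_ge_lower_bound => x; have [] := sad x ys.
move=> u y; rewrite valE; split.
  by apply: le_trans (Stilde_le_self _ _) _; have [] := sad us y.
by apply: Stilde_ge_lower_bound => x; have [] := sad x ys.
Qed.

(** The gradient inequalities at [(x, y)], tested at [us] and [ys], are chained by
    [S us y <= S us ys <= S x ys]. Splitting [u - us] as [(u - x) - (us - x)] leaves the term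
    [rho |u - x|^2]. *)
Lemma proxgrad_monotone us ys u y : saddle_point S us ys ->
  rho * sqnorm (u - X u y) <=
    dotv (rho *: (u - X u y)) (u - us) - dotv (grad2 S (X u y) y) (y - ys).
Proof.
move=> sad; set x := X u y.
have := grad1_le S_C1 S_cc x y us; rewrite (grad1_xtilde S_cc S_C1 rho_gt0) -/x.
have := grad2_ge S_C1 S_cc x y ys; have [+ _] := sad x y; have [_] := sad x ys.
have -> : u - us = (u - x) - (us - x) by rewrite opprB addrA subrK.
by rewrite -(opprB y ys) dotvDr !dotvNr !dotvZl -sqnormE; lra.
Qed.

(** A vanishing first term forces [X u y = u], so both partial gradients of [S] vanish at [(u, y)]
    itself. *)
Lemma proxgrad0_saddle u y :
  sqnorm (rho *: (u - X u y)) + sqnorm (grad2 S (X u y) y) = 0 -> saddle_point S u y.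
Proof.
move=> /eqP; rewrite paddr_eq0 ?sqnorm_ge0 // !sqnorm_eq0 scaler_eq0 gt_eqF //=.
rewrite subr_eq0 => /andP[/eqP uX /eqP g2].
apply: (saddle_point_grad0 S_C1 S_cc); last by rewrite [in LHS]uX.
by rewrite [in LHS]uX (grad1_xtilde S_cc S_C1 rho_gt0) -uX subrr scaler0.
Qed.

(** * Lyapunov estimates and convergence of a trajectory *)

Section Trajectory.
Variables (u : R -> 'rV[R]_n) (y : R -> 'rV[R]_m).

Local Notation a t := (rho *: (u t - X (u t) (y t))).
Local Notation b t := (grad2 S (X (u t) (y t)) (y t)).
(** The squared Euclidean speed, the velocity being [(- a t, b t)]. *)
Local Notation speed t := (sqnorm (a t) + sqnorm (b t)).
Local Notation V us ys t := (sqnorm (u t - us) + sqnorm (y t - ys)).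
Local Notation V' us ys t :=
  (- 2 * (dotv (a t) (u t - us) - dotv (b t) (y t - ys))).

Hypothesis u_flow : forall t : R, 0 < t -> is_derive t 1 u (- a t).
Hypothesis y_flow : forall t : R, 0 < t -> is_derive t 1 y (b t).

Lemma is_derive_sqdist us ys (t : R) : 0 < t ->
  is_derive t 1 (fun s => V us ys s) (V' us ys t).
Proof.
move=> t0.
have sq_center k (c p : 'rV[R]_k) :
    is_diff p (fun q => sqnorm (q - c)) (dotv (2 *: (p - c))).
  have dB : is_diff p (fun q => q - c) (id - cst 0).
    exact: (is_diffB (is_diff_id _) (is_diff_cst _ _)).
  apply: is_diff_eq (is_diff_comp dB (is_diff_sqnorm (p - c))) _.
  by apply/funext => v /=; rewrite /cst /= subr0.
have du := is_derive_comp_diff (u_flow t0) (sq_center _ us (u t)).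
have dy := is_derive_comp_diff (y_flow t0) (sq_center _ ys (y t)).
apply: is_derive_eq (is_deriveD du dy) _.
rewrite dotvNr (dotvZl _ 2) (dotvZl (b t)) (dotvC (u t - us)) (dotvC (y t - ys)).
ring.
Qed.

Lemma is_derive_Stilde_flow (t : R) : 0 < t ->
  is_derive t 1 (fun s => Stilde S rho (u s) (y s)) (sqnorm (b t) - sqnorm (a t)).
Proof.
move=> t0; have dM := is_diff_Stilde S_cc S_C1 rho_gt0 (u t, y t).
apply: is_derive_eq (is_derive_comp_diff (is_derive_pair (u_flow t0) (y_flow t0)) dM) _.
by rewrite /= dotvNr -!sqnormE addrC.
Qed.

(** By [proxgrad_monotone], [V'] is at most [-2 rho |u - x|^2]. The initial time [s] is positive
    because the differential equation holds only there. *)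
Lemma sqdist_nonincreasing us ys (s t : R) : saddle_point S us ys -> 0 < s -> s <= t ->
  V us ys t <= V us ys s.
Proof.
move=> sad s0 st; rewrite -subr_le0 -(mul0r (t - s)).
apply: (@derive_le_increment _ (fun r => V us ys r) (fun r => V' us ys r) 0 s t st) =>
    r sr _; first by apply: is_derive_sqdist; exact: lt_le_trans sr.
have := proxgrad_monotone (u r) (y r) sad.
by have := mulr_ge0 (ltW rho_gt0) (sqnorm_ge0 (u r - X (u r) (y r))); lra.
Qed.

(* [rho * V - Stilde] decreases at rate at least [speed] and is bounded below:
   [V' <= -2 rho |u - x|^2] pays for the term [rho^2 |u - x|^2] of [-Stilde']. *)
Lemma speed_small us ys (T e : R) : saddle_point S us ys -> 0 < T -> 0 < e ->
  exists2 t, T <= t & speed t < e.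
Proof.
move=> sad T0 e0; apply: contrapT => no_t.
have speed_ge t : T <= t -> e <= speed t.
  by move=> Tt; rewrite leNgt; apply/negP => lte; apply: no_t; exists t.
pose W t := rho * V us ys t - Stilde S rho (u t) (y t).
(* Testing the minimum at [us] and using the saddle inequality bounds the envelope by
   [S us ys + rho / 2 |u - us|^2], whose quadratic part [rho * V] absorbs. *)
have W_ge t : - S us ys <= W t.
  have := Stilde_le S_cc S_C1 rho_gt0 (u t) (y t) us; rewrite /prox_objective.
  have [+ _] := sad us (y t); rewrite -(opprB (u t)) sqnormN /W.
  have := mulr_ge0 (ltW rho_gt0) (sqnorm_ge0 (u t - us)).
  have := mulr_ge0 (ltW rho_gt0) (sqnorm_ge0 (y t - ys)).
  by lra.
(* Decreasing at rate [e] until time [s] would bring [W] down to [- S us ys - 1] or less,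
   contradicting [W_ge]. *)
pose s := T + (W T + S us ys + 1) / e.
have Ts : T <= s by rewrite lerDl divr_ge0 ?ltW //; have := W_ge T; lra.
have W_diff t : T <= t -> is_derive t 1 W
    (rho * V' us ys t - (sqnorm (b t) - sqnorm (a t))).
  move=> Tt; have t0 := lt_le_trans T0 Tt.
  exact: (is_deriveB (is_deriveZ rho (is_derive_sqdist us ys t0))
    (is_derive_Stilde_flow t0)).
have : W s - W T <= - e * (s - T).
  apply: (@derive_le_increment _ W
    (fun t => rho * V' us ys t - (sqnorm (b t) - sqnorm (a t))) _ _ _ Ts) =>
    t Tt _; first exact: W_diff.
  have := speed_ge t Tt.
  have := ler_wpM2l (ltW rho_gt0) (proxgrad_monotone (u t) (y t) sad).
  by rewrite sqnormZ; lra.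
have -> : - e * (s - T) = - (W T + S us ys + 1) by rewrite /s; field; rewrite gt_eqF.
by have := W_ge s; lra.
Qed.

Lemma flow_cvg us ys : saddle_point S us ys ->
  exists us' ys', [/\ u t @[t --> +oo] --> us', y t @[t --> +oo] --> ys' &
    saddle_point S us' ys'].
Proof.
move=> sad.
have /choice[tau tauP] k : exists t : R, k.+1%:R <= t /\ speed t < k.+1%:R^-1.
  by have [|| t] := @speed_small us ys k.+1%:R k.+1%:R^-1 sad;
    rewrite ?invr_gt0 ?ltr0n //; exists t.
have tau_gt0 k : 0 < tau k by apply: lt_le_trans (tauP k).1.
pose z k := (u (tau k), y (tau k)).
(* Every [tau k] is at least 1, a time at which monotonicity of the distance applies. *)
pose C := V us ys 1.
pose K := [set q | sqnorm (q - us) <= C] `*` [set q | sqnorm (q - ys) <= C].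
have zK k : K (z k).
  have : V us ys (tau k) <= C.
    by apply: sqdist_nonincreasing => //; apply: le_trans (tauP k).1; rewrite ler1n.
  have := sqnorm_ge0 (u (tau k) - us); have := sqnorm_ge0 (y (tau k) - ys).
  by rewrite /K /z /= => ? ? ?; split => /=; lra.
have K_compact : compact K by apply: compact_setX; exact: compact_sqnorm_ball.
have [p [_ p_cluster]] : K `&` cluster (z @ \oo) !=set0.
  by apply: K_compact; exists 0 => // k _; exact: zK.
(* The squared speed as a function of the state: [A (z k)] is [speed (tau k)]. *)
pose A (q : 'rV[R]_n * 'rV[R]_m) :=
  sqnorm (rho *: (q.1 - X q.1 q.2)) + sqnorm (grad2 S (X q.1 q.2) q.2).
have A_cont : continuous A.
  apply: continuous_sqnormD.
    exact: (continuous_proxgrad1 S_cc S_C1 rho_gt0).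
  exact: (continuous_proxgrad2 S_cc S_C1 rho_gt0).
have A_ge0 q : 0 <= A q by rewrite addr_ge0 ?sqnorm_ge0.
have p_saddle : saddle_point S p.1 p.2.
  apply: proxgrad0_saddle; apply/eqP; rewrite -/(A p) eq_le A_ge0 andbT leNgt.
  (* If [A p] were positive, [A] would exceed [A p / 2] near [p] but stay below it at all late
     [z k], which is impossible at a cluster point. *)
  apply/negP => Ap.
  have Ap2 : 0 < A p / 2 by rewrite divr_gt0.
  have A_small : (z @ \oo) [set q | A q < A p / 2].
    have := near_infty_natSinv_lt (PosNum Ap2); apply: filterS => k /=.
    by apply: lt_trans; exact: (tauP k).2.
  have A_big : nbhs p [set q | A p / 2 < A q].
    have /cvgr_gt := A_cont p; apply; rewrite ltr_pdivrMr // ltr_pMr //; lra.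
  have [q [/= q1 q2]] := p_cluster _ _ A_small A_big.
  by have := lt_trans q1 q2; rewrite ltxx.
have dist_small e : 0 < e -> exists k, V p.1 p.2 (tau k) < e.
  move=> e0.
  have d_cont : continuous (fun q : 'rV[R]_n * 'rV[R]_m =>
      sqnorm (q.1 - p.1) + sqnorm (q.2 - p.2)).
    apply: (@continuous_sqnormD R ('rV[R]_n * 'rV[R]_m)%type n m
      (fun q => q.1 - p.1) (fun q => q.2 - p.2)) => q.
      by apply: (@continuousB _ _ _ fst (cst p.1));
        [exact: cvg_fst | exact: cst_continuous].
    by apply: (@continuousB _ _ _ snd (cst p.2));
      [exact: cvg_snd | exact: cst_continuous].
  have near_p : nbhs p [set q | sqnorm (q.1 - p.1) + sqnorm (q.2 - p.2) < e].
    by have /cvgr_lt := d_cont p; apply; rewrite !subrr !sqnorm0 addr0.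
  have z_range : (z @ \oo) (range z) by exists 0 => // k _; exists k.
  by have [_ [[k _ <-] zk]] := p_cluster _ _ z_range near_p; exists k.
(* As [p] is itself a saddle point, the distance to it is nonincreasing, so one close time controls
   all later times. *)
have dist_cvg e : 0 < e -> \forall t \near +oo, V p.1 p.2 t < e.
  move=> /dist_small[k Vk]; apply: filterS (nbhs_pinfty_ge (num_real (tau k))) => t kt.
  by apply: le_lt_trans Vk; exact: sqdist_nonincreasing.
exists p.1, p.2; split=> //; apply: cvg_sqnorm_norm => e /dist_cvg; apply: filterS => t.
  by have := sqnorm_ge0 (y t - p.2); lra.
by have := sqnorm_ge0 (u t - p.1); lra.
Qed.

End Trajectory.

End SaddleFlow.

Theorem corollary6 (R : realType) (n m : nat)
    (S : 'rV[R]_n -> 'rV[R]_m -> R) (rho : R)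
    (S_convex_concave : convex_concave S)
    (S_C1 : continuously_differentiable S)
    (S_saddle : exists xs ys, saddle_point S xs ys)
    (rho_gt0 : 0 < rho) :
  [/\ (forall u y,
        minimizer (prox_objective S rho u y) = [set xtilde S rho u y]),
      continuously_differentiable (Stilde S rho),
      (forall u y,
        grad1 (Stilde S rho) u y = rho *: u - rho *: xtilde S rho u y /\
        grad2 (Stilde S rho) u y = grad2 S (xtilde S rho u y) y)
    & (forall (u : R -> 'rV[R]_n) (y : R -> 'rV[R]_m),
        prox_saddle_flow S rho u y ->
        exists (us : 'rV[R]_n) (ys : 'rV[R]_m),
          [/\ u t @[t --> +oo] --> us,
              y t @[t --> +oo] --> ys,
              saddle_point (Stilde S rho) us ys
            & saddle_point S us ys])].
Proof.
split.
- exact: minimizer_prox_uniq.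
- exact: continuously_differentiable_Stilde.
- move=> u y; split; first by rewrite grad1_Stilde // scalerBr.
  exact: grad2_Stilde.
move=> u y [_ _ u_flow y_flow]; have [xs [ys sad]] := S_saddle.
have u_flow' (t : R) : 0 < t ->
    is_derive t 1 u (- (rho *: (u t - xtilde S rho (u t) (y t)))).
  by move=> t0; rewrite -grad1_Stilde //; exact: u_flow.
have y_flow' (t : R) : 0 < t ->
    is_derive t 1 y (grad2 S (xtilde S rho (u t) (y t)) (y t)).
  by move=> t0; rewrite -grad2_Stilde //; exact: y_flow.
have [us [ys' [u_cvg y_cvg sad']]] :=
  flow_cvg S_convex_concave S_C1 rho_gt0 u_flow' y_flow' sad.
by exists us, ys'; split=> //; exact: saddle_point_Stilde.
Qed.
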